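(* Let $K=R[x,y]/(x(x-p),y(y-p))$ be the Kleinian 4-ring over $R$ and $A=K+Rz$ its minimal over-ring. Let $M$ be an indecomposable regular $A$-lattice (i.e. an indecomposable $A$-lattice belonging to a tube) and $n>0$ an integer. Put $$M(n)=\begin{cases}M_{pp}&\text{if } n\text{ is even},\\ M_{0p}&\text{if } n\text{ is odd and } M\notin\mathcal T^\infty,\\ M_{p0}&\text{if } n\text{ is odd and } M\in\mathcal T^\infty.\end{cases}$$ For $a\in M(n)$ let $\xi_a:P_n\to M$ be the $K$-homomorphism given, for $0\le k\le n$, by: if $M\notin\mathcal T^\infty$, $\xi_a(u^kv^{n-k})=a$ for $k=n$ and $0$ otherwise; if $M\in\mathcal T^\infty$, $\xi_a(u^kv^{n-k})=a$ for $k=0$ and $0$ otherwise. Then $\xi_a$ is a cocycle, and the map $a\mapsto\xi_a$ induces an isomorphism $$\xi:\ M(n)/pM(n)\ \simeq\ \widehat H^n(K,M).$$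
   Context: $R$ is a complete discrete valuation ring with prime element $p$, field of fractions $Q$ and residue field $\Bbbk=R/pR$. $K=R[x,y]/(x(x-p),y(y-p))$ is embedded in $Q^4$ by $x\mapsto(p,p,0,0)$, $y\mapsto(p,0,p,0)$; $z=(p,0,0,0)$, $A=K+Rz$, a local ring with maximal ideal $\mathfrak m=(p,x,y,z)=pA^\sharp$, where $A^\sharp=R^4$. A lattice is a module finitely generated and free over $R$. For an $A$-lattice $M$ and $\alpha,\beta\in\{0,p\}$, $M_{\alpha\beta}=\{v\in M\mid xv=\alpha v,\ yv=\beta v\}$; $M^\sharp=A^\sharp M=\bigoplus_{\alpha\beta}M^\sharp_{\alpha\beta}$. Cohomology. $R$ is a $K$-module via $x,y\mapsto p$. A free resolution $\mathbf P$ of $R$ over $K$ is: $P_n$ ($n\ge0$) is the free $K$-module of homogeneous polynomials of degree $n$ in $K[u,v]$, with basis $u^iv^j$, $i+j=n$, and $d(u^iv^j)=C_i(x)u^{i-1}v^j+(-1)^iC_j(y)u^iv^{j-1}$, where $C_i(x)=x$ if $i>0$ is even, $C_i(x)=x-p$ if $i$ is odd (similarly $C_j(y)$), and terms with a negative exponent are omitted. For $n>0$, $\widehat H^n(K,M)=H^n(K,M)=\mathrm{Ext}^n_K(R,M)$ is the $n$-th cohomology of $\mathrm{Hom}_K(\mathbf P,M)$, with differential $\gamma\mapsto\gamma\circ d$. Tubes. Let $\Gamma$ be the quiver with vertices $\bullet,pp,p0,0p,00$ and one arrow from $\bullet$ to each of the other four. To an $A$-lattice $M$ one attaches the representation $V=\Phi(M)$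 of $\Gamma$ over $\Bbbk$ with $V_\bullet=M/\mathfrak mM$, $V_{\alpha\beta}=M^\sharp_{\alpha\beta}/pM^\sharp_{\alpha\beta}$ and natural maps $f_{\alpha\beta}:V_\bullet\to V_{\alpha\beta}$. This gives a bijection between isomorphism classes of $A$-lattices and of representations with all $f_{\alpha\beta}$ surjective and $V_\bullet\to\bigoplus V_{\alpha\beta}$ injective; $M$ is recovered as the preimage of the image of $V_\bullet$ in $M^\sharp=\bigoplus R_{\alpha\beta}^{\dim V_{\alpha\beta}}$, where $R_{\alpha\beta}$ is $R$ with $x,y$ acting as $\alpha,\beta$. The vector rank $\mathrm{Rk}\,M=(d_\bullet\mid d_{pp},d_{p0},d_{0p},d_{00})$ is the dimension vector of $\Phi(M)$. The regular components of the Auslander–Reiten quiver of $A$-lattices (those corresponding to the regular components for $\Gamma$) are tubes parametrized by $\mathbb P=\{\text{monic irreducible } f(t)\in\Bbbk[t]\}\cup\{\infty\}$; $\mathcal T^\lambda=\mathcal T^{t-\lambda}$ for $\lambda\in\Bbbk$. For $f\ne t,t-1,\infty$, $d=\deg f$, $\mathcal T^f$ consists of indecomposable lattices $T^f_m$, $m\ge1$, with $\mathrm{Rk}\,T^f_m=(2dm\mid dm,dm,dm,dm)$; $T^f_1$ corresponds to $V_\bullet=\Bbbk^{2d}$, $V_{\alpha\beta}=\Bbbk^d$, $f_{pp}=(I\ 0)$, $f_{p0}=(0\ I)$, $f_{0p}=(I\ I)$, $f_{00}=(I\ F)$ with $F$ the Frobenius (companion) matrix with characteristic polynomial $f$, and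 there are exact sequences $0\to T^f_1\to T^f_{m+1}\to T^f_m\to0$ and $0\to T^f_m\to T^f_{m+1}\to T^f_1\to0$. For $\lambda\in\{0,1,\infty\}$, $\mathcal T^\lambda$ consists of indecomposable lattices $T^{\lambda i}_m$, $i\in\{1,2\}$, $m\ge1$; there are irreducible monomorphisms $T^{\lambda i}_m\to T^{\lambda i}_{m+1}$ with cokernel $T^{\lambda j}_1$ ($j=i$ if $m$ is even, $j\neq i$ if $m$ is odd) and irreducible epimorphisms $T^{\lambda i}_{m+1}\to T^{\lambda j}_m$ ($j\ne i$) with kernel $T^{\lambda i}_1$. For $\lambda=1$: $\mathrm{Rk}\,T^{1i}_{2m}=(2m\mid m,m,m,m)$, $\mathrm{Rk}\,T^{11}_{2m-1}=(2m-1\mid m,m,m-1,m-1)$, $\mathrm{Rk}\,T^{12}_{2m-1}=(2m-1\mid m-1,m-1,m,m)$. The vector ranks for $\lambda=0$ (respectively $\lambda=\infty$) are obtained by interchanging $d_{p0}$ with $d_{00}$ (respectively with $d_{0p}$). An $A$-lattice is regular if all its indecomposable direct summands belong to tubes. *)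

(* Defs.v *)
From HB Require Import structures.
From mathcomp Require Import all_boot all_order all_algebra.
From mathcomp Require Import boolp classical_sets functions.
From mathcomp Require Import ring.

Set Implicit Arguments.
Unset Strict Implicit.
Unset Printing Implicit Defensive.

Import GRing.Theory.
Local Open Scope ring_scope.

Definition divides (R : comNzRingType) (p a : R) : Prop := exists b, a = b * p.

(* [R] is a principal ideal domain, but not a field, whose nonunits are the
   multiples of [p] (so it is local and [p] is a prime element), and every
   Cauchy sequence of the [p]-adic topology converges. *)
Record complete_dvr (R : idomainType) (p : R) : Prop := CompleteDvr {
  cdvr_principal : forall I : {pred R},
    0 \in I -> {in I &, forall a b, a + b \in I} ->
    (forall a, {in I, forall b, a * b \in I}) ->
    exists c, forall a, (a \in I) <-> divides c a;
  cdvr_maximal : forall a, (a \isn't a GRing.unit) <-> divides p a;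
  cdvr_prime_neq0 : p != 0;
  cdvr_complete : forall s : nat -> R,
    (forall n, divides (p ^+ n) (s n.+1 - s n)) ->
    exists l, forall n, divides (p ^+ n) (l - s n)
}.

(* [rho] identifies [k] with the residue field R / pR. *)
Definition residue_map (R : idomainType) (p : R) (k : fieldType)
    (rho : {rmorphism R -> k}) : Prop :=
  (forall c, exists a, rho a = c) /\ (forall a, rho a = 0 <-> divides p a).

(* A^# = R^4, with coordinates in the order pp, p0, 0p, 00. *)
Notation R4 R := (R * R * R * R)%type.

Section Rings.
Variables (R : idomainType) (p : R).
Local Notation R4 := (R4 R).

Definition constR4 (r : R) : R4 := (r, r, r, r).

Fact constR4_zmod_morphism : zmod_morphism constR4. Proof. by []. Qed.
Fact constR4_monoid_morphism : monoid_morphism constR4. Proof. by []. Qed.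
HB.instance Definition _ :=
  GRing.isZmodMorphism.Build R R4 constR4 constR4_zmod_morphism.
HB.instance Definition _ :=
  GRing.isMonoidMorphism.Build R R4 constR4 constR4_monoid_morphism.

Definition x4 : R4 := (p, p, 0, 0).
Definition y4 : R4 := (p, 0, p, 0).
Definition z4 : R4 := (p, 0, 0, 0).

(* The R-algebra morphism R[x,y] -> R^4 sending x, y to [x4], [y4]; the inner
   polynomial variable is x and the outer one is y. *)
Definition ev1 (c : {poly R}) : R4 := (map_poly constR4 c).[x4].
Definition ev (q : {poly {poly R}}) : R4 := (map_poly ev1 q).[y4].

Lemma ev1E c : ev1 c = (c.[p], c.[p], c.[0], c.[0]).
Proof.
rewrite /ev1; elim/poly_ind: c => [|c r IH]; first by rewrite map_poly0 !horner0.
rewrite rmorphD rmorphM /= map_polyX map_polyC /= !hornerMXaddC IH.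
by congr (_, _, _, _).
Qed.

Fact ev1_zmod_morphism : zmod_morphism ev1.
Proof. by move=> a b; rewrite /ev1 rmorphB hornerD hornerN. Qed.
Fact ev1_monoid_morphism : monoid_morphism ev1.
Proof.
by split=> [|a b]; rewrite /ev1 ?rmorph1 ?hornerC // rmorphM hornerM.
Qed.
HB.instance Definition _ :=
  GRing.isZmodMorphism.Build {poly R} R4 ev1 ev1_zmod_morphism.
HB.instance Definition _ :=
  GRing.isMonoidMorphism.Build {poly R} R4 ev1 ev1_monoid_morphism.

Fact ev_zmod_morphism : zmod_morphism ev.
Proof. by move=> a b; rewrite /ev rmorphB hornerD hornerN. Qed.
Fact ev_monoid_morphism : monoid_morphism ev.
Proof.
by split=> [|a b]; rewrite /ev ?rmorph1 ?hornerC // rmorphM hornerM.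
Qed.
HB.instance Definition _ :=
  GRing.isZmodMorphism.Build {poly {poly R}} R4 ev ev_zmod_morphism.
HB.instance Definition _ :=
  GRing.isMonoidMorphism.Build {poly {poly R}} R4 ev ev_monoid_morphism.

Lemma evE q : ev q =
  (q.[p%:P].[p], q.[0].[p], q.[p%:P].[0], q.[0].[0]).
Proof.
elim/poly_ind: q => [|q c IH]; first by rewrite /ev map_poly0 !horner0.
have -> : ev (q * 'X + c%:P) = ev q * y4 + ev1 c.
  by rewrite /ev rmorphD rmorphM /= map_polyX map_polyC hornerMXaddC.
rewrite IH ev1E !hornerMXaddC !(hornerE, hornerD, hornerM, hornerC).
have H (a b : R) : a * 0 + b = b by rewrite mulr0 add0r.
by congr (_, _, _, _); apply: H.
Qed.

(* K: the image of R[x,y] in R^4.  By [evP], the kernel is the ideal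
   (x(x-p), y(y-p)). *)
Definition K_pred : {pred R4} := [pred u | `[< exists q, u = ev q >]].

Lemma evP (q : {poly {poly R}}) : p != 0 ->
  ev q = 0 <-> exists a b : {poly {poly R}},
    q = a * ('X * ('X - p%:P))%:P + b * ('X * ('X - p%:P%:P)).
Proof.
move=> p0; split; last first.
  move=> [a [b ->]]; rewrite evE !(hornerE, hornerD, hornerM, hornerC).
  by rewrite /= !(subrr, mul0r, mulr0, addr0).
have div1 (c : {poly R}) : c.[p] = 0 -> c.[0] = 0 ->
    exists d, c = d * ('X * ('X - p%:P)).
  move=> /eqP /factor_theorem [d ->] /eqP.
  rewrite hornerM mulf_eq0 hornerXsubC sub0r oppr_eq0 (negbTE p0) orbF.
  by move=> /factor_theorem [e ->]; exists e; rewrite subr0 -mulrA.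
move=> /[dup] /[1! evE] -[q1 q2 q3 q4] _.
have [a Ea] := div1 _ q2 q4.
have [b Eb] : exists b, q = q.[0]%:P + b * 'X.
  have /factor_theorem [b Eb] : root (q - q.[0]%:P) 0.
    by rewrite /root !hornerE subrr.
  by exists b; move: Eb; rewrite subr0 => <-; rewrite addrC subrK.
have bE : b.[p%:P] * p%:P = q.[p%:P] - q.[0].
  by rewrite [in RHS]Eb !hornerE; ring.
have [||d Ed] := div1 b.[p%:P].
- by have /(congr1 (horner^~ p)) := bE; rewrite !hornerE q1 q2 subrr;
    move/eqP; rewrite mulf_eq0 (negbTE p0) orbF => /eqP.
- by have /(congr1 (horner^~ 0)) := bE; rewrite !hornerE q3 q4 subrr;
    move/eqP; rewrite mulf_eq0 (negbTE p0) orbF => /eqP.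
have /factor_theorem [e Ee] : root (b - b.[p%:P]%:P) p%:P.
  by rewrite /root !hornerE subrr.
exists (a%:P + d%:P * 'X), e.
rewrite Eb Ea -[b in LHS](subrK b.[p%:P]%:P) Ee Ed !polyCM.
by ring.
Qed.

Fact K_subring_closed : subring_closed K_pred.
Proof.
split=> [|_ _ /asboolP[a ->] /asboolP[b ->]|_ _ /asboolP[a ->] /asboolP[b ->]];
  apply/asboolP.
- by exists 1; rewrite rmorph1.
- by exists (a - b); rewrite rmorphB.
- by exists (a * b); rewrite rmorphM.
Qed.
HB.instance Definition _ :=
  GRing.isSubringClosed.Build R4 K_pred K_subring_closed.

Record kleinian : Type := Kleinian { K_val : R4; _ : K_val \in K_pred }.
HB.instance Definition _ := [isSub of kleinian for K_val].
HB.instance Definition _ := [Choice of kleinian by <:].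
HB.instance Definition _ := [SubChoice_isSubComNzRing of kleinian by <:].

Definition A_pred : {pred R4} := [pred u |
  `[< exists (k : kleinian) (r : R), u = val k + constR4 r * z4 >]].

Fact A_subring_closed : subring_closed A_pred.
Proof.
have K_z4 (u : R4) : exists r, u * z4 = constR4 r * z4.
  exists u.1.1.1; case: u => [[[a b] c] d].
  by congr (_, _, _, _); rewrite /= !mulr0.
split=> [|_ _ /asboolP[k [r ->]] /asboolP[l [s ->]]
         |_ _ /asboolP[k [r ->]] /asboolP[l [s ->]]]; apply/asboolP.
- by exists 1, 0; rewrite rmorph1 rmorph0; ring.
- by exists (k - l), (r - s); rewrite !rmorphB /=; ring.
- have [t Et] := K_z4 (val k * constR4 s + val l * constR4 r
                       + constR4 r * constR4 s * z4).
  by exists (k * l), t; rewrite rmorphM -Et /=; ring.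
Qed.
HB.instance Definition _ :=
  GRing.isSubringClosed.Build R4 A_pred A_subring_closed.

Record overring : Type := Overring { A_val : R4; _ : A_val \in A_pred }.
HB.instance Definition _ := [isSub of overring for A_val].
HB.instance Definition _ := [Choice of overring by <:].
HB.instance Definition _ := [SubChoice_isSubComNzRing of overring by <:].

Fact x4_in_K : x4 \in K_pred.
Proof.
apply/asboolP; exists 'X%:P.
by rewrite /ev map_polyC hornerC /= /ev1 map_polyX hornerX.
Qed.
Fact y4_in_K : y4 \in K_pred.
Proof. by apply/asboolP; exists 'X; rewrite /ev map_polyX hornerX. Qed.
Fact constR4_in_K r : constR4 r \in K_pred.
Proof.
apply/asboolP; exists r%:P%:P.
by rewrite /ev map_polyC hornerC /= /ev1 map_polyC hornerC.
Qed.

Definition xK : kleinian := Kleinian x4_in_K.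
Definition yK : kleinian := Kleinian y4_in_K.
Definition constK (r : R) : kleinian := Kleinian (constR4_in_K r).

Fact K_sub_A (k : kleinian) : val k \in A_pred.
Proof. by apply/asboolP; exists k, 0; rewrite rmorph0 mul0r addr0. Qed.
Fact z4_in_A : z4 \in A_pred.
Proof. by apply/asboolP; exists 0, 1; rewrite rmorph0 rmorph1 mul1r add0r. Qed.

Definition inclKA (k : kleinian) : overring := Overring (K_sub_A k).

Fact inclKA_zmod_morphism : zmod_morphism inclKA.
Proof. by move=> k l; apply/val_inj. Qed.
Fact inclKA_monoid_morphism : monoid_morphism inclKA.
Proof. by split=> [|k l]; apply/val_inj. Qed.
HB.instance Definition _ :=
  GRing.isZmodMorphism.Build kleinian overring inclKA inclKA_zmod_morphism.
HB.instance Definition _ :=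
  GRing.isMonoidMorphism.Build kleinian overring inclKA inclKA_monoid_morphism.

Definition xA : overring := inclKA xK.
Definition yA : overring := inclKA yK.
Definition zA : overring := Overring z4_in_A.
Definition constA (r : R) : overring := inclKA (constK r).
End Rings.

Section Lattices.
Variables (R : idomainType) (p : R).
Local Notation A := (overring p).

Definition lattice_over (B : comNzRingType) (c : R -> B) (M : lmodType B) :=
  exists (r : nat) (b : 'I_r -> M),
    forall v, exists! a : 'rV[R]_r, v = \sum_i c (a 0 i) *: b i.
Definition is_lattice (M : lmodType A) : Prop := lattice_over (constA p) M.

Definition indecomposable (M : lmodType A) : Prop :=
  (exists v : M, v != 0) /\
  forall S T : {pred M}, submod_closed S -> submod_closed T ->
    (forall v, v \in S -> v \in T -> v = 0) ->
    (forall v, exists2 s, s \in S & v - s \in T) ->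
    (forall v, v \in S -> v = 0) \/ (forall v, v \in T -> v = 0).

Definition short_exact (L M N : lmodType A)
    (i : {linear L -> M}) (q : {linear M -> N}) : Prop :=
  [/\ injective i, forall w, exists v, q v = w
    & forall v, q v = 0 <-> exists u, i u = v].

Definition split_mono (M N : lmodType A) (f : {linear M -> N}) : Prop :=
  exists g : {linear N -> M}, cancel f g.
Definition split_epi (M N : lmodType A) (f : {linear M -> N}) : Prop :=
  exists g : {linear N -> M}, cancel g f.
Definition irreducible_mor (M N : lmodType A) (f : {linear M -> N}) : Prop :=
  [/\ ~ split_mono f, ~ split_epi f
    & forall (X : lmodType A) (g : {linear M -> X}) (h : {linear X -> N}),
        is_lattice X -> f =1 h \o g -> split_mono g \/ split_epi h].

Inductive vertex := Vpp | Vp0 | V0p | V00.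

Definition xval (e : vertex) : R := match e with Vpp | Vp0 => p | _ => 0 end.
Definition yval (e : vertex) : R := match e with Vpp | V0p => p | _ => 0 end.
Definition idem (e : vertex) : R4 R :=
  match e with
  | Vpp => (1, 0, 0, 0) | Vp0 => (0, 1, 0, 0)
  | V0p => (0, 0, 1, 0) | V00 => (0, 0, 0, 1)
  end.

(* M_{alpha beta}, for M over A and for M^# over A^#. *)
Definition component (M : lmodType A) (e : vertex) : set M :=
  [set v | xA p *: v = constA p (xval e) *: v
         /\ yA p *: v = constA p (yval e) *: v].
Definition component4 (N : lmodType (R4 R)) (e : vertex) : set N :=
  [set v | x4 p *: v = constR4 (xval e) *: v
         /\ y4 p *: v = constR4 (yval e) *: v].

Definition maxideal_mul (M : lmodType A) : set M :=
  [set v | exists v1 v2 v3 v4 : M,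
     v = constA p p *: v1 + xA p *: v2 + yA p *: v3 + zA p *: v4].

(* [j : M -> N] identifies the A^#-module N with M^# = A^# M: N is torsion-free
   over R, and it is generated over A^# by the copy [j M] of M. *)
Definition is_sharp (M : lmodType A) (N : lmodType (R4 R)) (j : M -> N) :=
  [/\ forall (a : A) u v, j (a *: u + v) = val a *: j u + j v,
      injective j,
      forall (r : R) (w : N), constR4 r *: w = 0 -> r = 0 \/ w = 0
    & forall w, exists (n : nat) (a : 'I_n -> R4 R) (v : 'I_n -> M),
        w = \sum_i a i *: j (v i)].

Variables (k : fieldType) (rho : {rmorphism R -> k}).

(* [pi] induces an isomorphism of k-spaces S / S0 -> k^n, where S0 <= S are
   R-submodules of N and S0 contains p S. *)
Definition residual_coords (B : comNzRingType) (c : R -> B) (N : lmodType B)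
    (S S0 : set N) (n : nat) (pi : N -> 'cV[k]_n) : Prop :=
  [/\ forall r u v, S u -> S v -> pi (c r *: u + v) = rho r *: pi u + pi v,
      forall w, exists2 v, S v & pi v = w
    & forall v, S v -> (pi v = 0 <-> S0 v)].

(* Representations of Gamma in coordinates, and the relation Phi(M) ~= V. *)
Definition rep (d0 : nat) (d : vertex -> nat) : Type :=
  forall e, 'M[k]_(d e, d0).

Definition Phi_iso (M : lmodType A) d0 d (V : rep d0 d) : Prop :=
  exists (N : lmodType (R4 R)) (j : M -> N), is_sharp j /\
  exists (pi0 : M -> 'cV[k]_d0) (pi : forall e, N -> 'cV[k]_(d e)),
  [/\ residual_coords (constA p) setT (@maxideal_mul M) pi0,
      forall e, residual_coords (@constR4 R) (@component4 N e)
        [set constR4 p *: w | w in @component4 N e] (pi e)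
    & forall e v, pi e (idem e *: j v) = V e *m pi0 v].

(* Rk M = (d0 | d). *)
Definition Rk (M : lmodType A) (d0 : nat) (d : vertex -> nat) : Prop :=
  exists V : rep d0 d, Phi_iso M V.

Definition tube_rep (f : {poly k}) :
    rep ((size f).-1 + (size f).-1)%N (fun=> (size f).-1) :=
  fun e => match e with
  | Vpp => row_mx 1%:M 0
  | Vp0 => row_mx 0 1%:M
  | V0p => row_mx 1%:M 1%:M
  | V00 => row_mx 1%:M (companionmx f)
  end.

(* [homogeneous f m M]: M is isomorphic to T^f_m, for f != t, t - 1.  In
   [HomogeneousS] the vector ranks add up, so that the exact sequences yield
   exact sequences of representations of Gamma; as M does not split, it is then
   determined by its ends up to isomorphism.  Likewise for [exceptional]. *)
Inductive homogeneous (f : {poly k}) : nat -> lmodType A -> Prop :=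
| Homogeneous1 (M : lmodType A) :
    is_lattice M -> indecomposable M -> Phi_iso M (tube_rep f) ->
    homogeneous f 1 M
| HomogeneousS (m : nat) (M L N L' N' : lmodType A)
    (i : {linear L -> M}) (q : {linear M -> N})
    (i' : {linear N' -> M}) (q' : {linear M -> L'}) :
    is_lattice M -> indecomposable M ->
    Rk M (2 * (size f).-1 * m.+1)%N (fun=> (size f).-1 * m.+1)%N ->
    homogeneous f 1 L -> homogeneous f m N -> short_exact i q ->
    homogeneous f m N' -> homogeneous f 1 L' -> short_exact i' q' ->
    homogeneous f m.+1 M.

(* The indices 0, 1, oo of the exceptional tubes. *)
Inductive special := At0 | At1 | Atoo.

(* [special_rank l i m] is the outer part of Rk T^{l i}_m; [i = false] stands
   for the first family and [i = true] for the second. *)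
Definition special_rank (l : special) (i : bool) (m : nat) (e : vertex) : nat :=
  let big := if i then m./2 else uphalf m in
  let small := if i then uphalf m else m./2 in
  match l, e with
  | At1, (Vpp | Vp0) | At0, (Vpp | V00) | Atoo, (Vpp | V0p) => big
  | _, _ => small
  end.

(* [exceptional l i m M]: M is isomorphic to T^{l i}_m. *)
Inductive exceptional (l : special) : bool -> nat -> lmodType A -> Prop :=
| Exceptional1 (i : bool) (M : lmodType A) :
    is_lattice M -> indecomposable M -> Rk M 1 (special_rank l i 1) ->
    exceptional l i 1 M
| ExceptionalS (i : bool) (m : nat) (M L N L' N' : lmodType A)
    (g : {linear N -> M}) (q : {linear M -> L})
    (g' : {linear L' -> M}) (q' : {linear M -> N'}) :
    is_lattice M -> indecomposable M -> Rk M m.+1 (special_rank l i m.+1) ->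
    exceptional l i m N -> exceptional l (if odd m then ~~ i else i) 1 L ->
    short_exact g q -> irreducible_mor g ->
    exceptional l i 1 L' -> exceptional l (~~ i) m N' ->
    short_exact g' q' -> irreducible_mor q' ->
    exceptional l i m.+1 M.

(* [in_tube (Some f) M] is M \in T^f and [in_tube None M] is M \in T^oo. *)
Definition in_tube (t : option {poly k}) (M : lmodType A) : Prop :=
  match t with
  | None => exists i m, exceptional Atoo i m M
  | Some f =>
      if f == 'X then exists i m, exceptional At0 i m M
      else if f == 'X - 1 then exists i m, exceptional At1 i m M
      else [/\ f \is monic, irreducible_poly f & exists m, homogeneous f m M]
  end.
End Lattices.

(* P_n; [delta_mx 0 i] is the basis element u^i v^(n-i). *)
Notation resol p n := 'rV[kleinian p]_n.+1.

Section Cohomology.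
Variables (R : idomainType) (p : R).
Local Notation K := (kleinian p).
Local Notation A := (overring p).

Local Notation P n := (resol p n).

Definition Cx (i : nat) : K := if odd i then xK p - constK p p else xK p.
Definition Cy (j : nat) : K := if odd j then yK p - constK p p else yK p.

(* u^i v^(n-i), for i <= n. *)
Definition monom (n i : nat) : P n := delta_mx 0 (inord i).

Definition diff (n : nat) (w : P n) : P n.-1 :=
  \sum_(i < n.+1) w 0 i *:
    ((if (0 < i)%N then Cx i *: monom n.-1 i.-1 else 0)
     + (if (0 < n - i)%N then (-1) ^+ i *: (Cy (n - i) *: monom n.-1 i) else 0)).

Variable M : lmodType A.

Definition K_linear (n : nat) (g : P n -> M) : Prop :=
  forall (c : K) u v, g (c *: u + v) = inclKA c *: g u + g v.

Definition cocycle (n : nat) : set (P n -> M) :=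
  [set g | K_linear g /\ forall w : P n.+1, g (diff w) = 0].
(* For n > 0 only: [diff] is 0 on P_0. *)
Definition coboundary (n : nat) : set (P n -> M) :=
  [set g | exists h : P n.-1 -> M, K_linear h /\ forall w : P n, g w = h (diff w)].

(* The K-homomorphism with prescribed values on the basis of P_n. *)
Definition hom_of (n : nat) (b : 'I_n.+1 -> M) (w : P n) : M :=
  \sum_(i < n.+1) inclKA (w 0 i) *: b i.
End Cohomology.

Arguments cocycle {R p} M n _.
Arguments coboundary {R p} M n _.

(* [f] maps S to T and induces an isomorphism of B-modules S / S0 -> T / T0. *)
Definition induces_iso (B : pzRingType) (U V : lmodType B)
    (S S0 : set U) (T T0 : set V) (f : U -> V) : Prop :=
  [/\ forall (b : B) u v, S u -> S v -> f (b *: u + v) = b *: f u + f v,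
      forall u, S u -> T (f u),
      forall u, S u -> (T0 (f u) <-> S0 u)
    & forall t, T t -> exists2 u, S u & T0 (t - f u)].

Section MainObjects.
Variables (R : idomainType) (p : R) (k : fieldType) (rho : {rmorphism R -> k}).
Variable M : lmodType (overring p).

Definition Mof (n : nat) : set M :=
  component (if ~~ odd n then Vpp
             else if `[< in_tube rho None M >] then Vp0 else V0p).

Definition xi (n : nat) (a : M) : resol p n -> M :=
  hom_of (fun i : 'I_n.+1 =>
    if i == (if `[< in_tube rho None M >] then 0 else n)%N :> nat then a else 0).
End MainObjects.

Arguments Mof {R p k} rho M n _.
Arguments xi {R p k} rho M n a _.

(* Main.v *)
(* Write [W = M^# / p M^#] and [V] for the image of [M] in [W]; the maximal ideal
   satisfies [m M = p M^#].  For [M] outside [T^oo], [V] is a complement in [W]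
   both of the part where [y = 0] and of the part where [y = p]: this is read
   off the defining representations at the mouth of each tube, and it passes to
   extensions because the vector ranks add up.  Hence every coefficient
   [y] or [y - p] of the differential can be inverted in the following sense: it
   detects [m M], and it maps [M] onto the elements of [m M] killed by the other
   one.  Given a cocycle [(w_0, ..., w_n)], induction on [i] first shows
   [w_i \in m M], and then solves for a coboundary that cancels
   [w_0, ..., w_(n-1)]; what remains is a cocycle concentrated at [u^n].  The same
   elimination shows that a coboundary concentrated at [u^n] has its value in
   [p M].  On [T^oo] the roles of [x] and [y] are exchanged, and the cochains are
   read backwards. *)
Require Import Defs.
From HB Require Import structures.
From mathcomp Require Import all_boot all_order all_algebra.
From mathcomp Require Import boolp classical_sets functions.
From mathcomp Require Import ring zify.

Import GRing.Theory.
Local Open Scope ring_scope.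
Local Open Scope classical_set_scope.

Set Implicit Arguments.
Unset Strict Implicit.
Unset Printing Implicit Defensive.

(** * Arithmetic of [A], its maximal ideal, and transversality *)

Section Overring.
Variables (R : idomainType) (p : R).
Local Notation A := (overring p).
Local Notation pA := (constA p p).
Local Notation maxideal M := (@maxideal_mul R p M).

Ltac coords :=
  apply/val_inj; rewrite [LHS]rmorphM [RHS]rmorphM;
  congr (_, _, _, _); rewrite /= ?mulr0 ?mul0r //.

Lemma xAxA : xA p * xA p = pA * xA p. Proof. coords. Qed.
Lemma yAyA : yA p * yA p = pA * yA p. Proof. coords. Qed.
Lemma xAyA : xA p * yA p = pA * zA p. Proof. coords. Qed.
Lemma xAzA : xA p * zA p = pA * zA p. Proof. coords. Qed.
Lemma yAzA : yA p * zA p = pA * zA p. Proof. coords. Qed.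

(** Explicit form of p A^# inside the maximal ideal (p, x, y, z) of [A]: the coefficients come from
    inclusion-exclusion on the supports of 1, x/p, y/p, z/p. *)
Lemma scale_pR4 (a : R4 R) : constR4 p * a =
  val (pA * constA p a.2 + xA p * constA p (a.1.1.2 - a.2)
       + yA p * constA p (a.1.2 - a.2)
       + zA p * constA p (a.1.1.1 - a.1.1.2 - a.1.2 + a.2)).
Proof.
case: a => [[[a1 a2] a3] a4]; rewrite !rmorphD !rmorphM.
by congr (_, _, _, _); rewrite /=; ring.
Qed.

Section MaxIdeal.
Variable M : lmodType A.

Lemma maxidealP (a : A) (u v : M) :
  maxideal M u -> maxideal M v -> maxideal M (a *: u + v).
Proof.
move=> [u1 [u2 [u3 [u4 ->]]]] [v1 [v2 [v3 [v4 ->]]]].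
exists (a *: u1 + v1), (a *: u2 + v2), (a *: u3 + v3), (a *: u4 + v4).
rewrite !scalerDr !scalerA ![a * _]mulrC.
rewrite addrACA; congr (_ + _); rewrite addrACA; congr (_ + _).
by rewrite addrACA.
Qed.

Lemma maxideal0 : maxideal M 0.
Proof. by exists 0, 0, 0, 0; rewrite !scaler0 !addr0. Qed.

Lemma maxidealZ (a : A) (u : M) : maxideal M u -> maxideal M (a *: u).
Proof. by move=> /(maxidealP a) /(_ maxideal0); rewrite addr0. Qed.

Lemma maxidealD (u v : M) : maxideal M u -> maxideal M v -> maxideal M (u + v).
Proof. by move=> /(maxidealP 1) h /h; rewrite scale1r. Qed.

Lemma maxidealN (u : M) : maxideal M u -> maxideal M (- u).
Proof. by move=> /(maxidealZ (-1)); rewrite scaleN1r. Qed.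

Lemma maxidealB (u v : M) : maxideal M u -> maxideal M v -> maxideal M (u - v).
Proof. by move=> mu /maxidealN; apply: maxidealD. Qed.

Lemma maxideal_p (u : M) : maxideal M (pA *: u).
Proof. by exists u, 0, 0, 0; rewrite !scaler0 !addr0. Qed.
Lemma maxideal_x (u : M) : maxideal M (xA p *: u).
Proof. by exists 0, u, 0, 0; rewrite !scaler0 !addr0 add0r. Qed.
Lemma maxideal_y (u : M) : maxideal M (yA p *: u).
Proof. by exists 0, 0, u, 0; rewrite !scaler0 !addr0 !add0r. Qed.

(** Here x = p e with e idempotent and m M = p M^# is stable under e. Without [M^#], this is visible
    on generators: x times each of p, x, y, z is p times an element of the maximal ideal. *)
Lemma x_maxideal (u : M) :
  maxideal M u -> exists2 v, maxideal M v & xA p *: u = pA *: v.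
Proof.
move=> [u1 [u2 [u3 [u4 ->]]]]; exists (xA p *: (u1 + u2) + zA p *: (u3 + u4)).
  by exists 0, (u1 + u2), 0, (u3 + u4); rewrite !scaler0 add0r addr0.
rewrite !scalerDr !scalerA xAxA xAyA xAzA [xA p * pA]mulrC.
by rewrite !addrA.
Qed.

Lemma y_maxideal (u : M) :
  maxideal M u -> exists2 v, maxideal M v & yA p *: u = pA *: v.
Proof.
move=> [u1 [u2 [u3 [u4 ->]]]]; exists (yA p *: (u1 + u3) + zA p *: (u2 + u4)).
  by exists 0, 0, (u1 + u3), (u2 + u4); rewrite !scaler0 !add0r.
rewrite !scalerDr !scalerA yAyA [yA p * xA p]mulrC xAyA yAzA [yA p * pA]mulrC.
by rewrite [RHS]addrACA !addrA.
Qed.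
End MaxIdeal.

Lemma maxideal_linear (M N : lmodType A) (q : {linear M -> N}) u :
  maxideal M u -> maxideal N (q u).
Proof.
move=> [u1 [u2 [u3 [u4 ->]]]]; exists (q u1), (q u2), (q u3), (q u4).
by rewrite !linearD !linearZ.
Qed.

Lemma maxideal_lift (M N : lmodType A) (q : {linear M -> N}) w :
  (forall w, exists v, q v = w) -> maxideal N w ->
  exists2 v, maxideal M v & q v = w.
Proof.
move=> qsurj [w1 [w2 [w3 [w4 ->]]]].
have [[u1 <-] [u2 <-]] := (qsurj w1, qsurj w2).
have [[u3 <-] [u4 <-]] := (qsurj w3, qsurj w4).
exists (pA *: u1 + xA p *: u2 + yA p *: u3 + zA p *: u4).
  by exists u1, u2, u3, u4.
by rewrite !linearD !linearZ.
Qed.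

(* [t] is [p] times an idempotent of [A^#] acting on every [m M = p M^#]. *)
Definition pidem (t : A) : Prop :=
  [/\ t * t = pA * t,
      forall (M : lmodType A) u, maxideal M (t *: u)
    & forall (M : lmodType A) u, maxideal M u ->
        exists2 v, maxideal M v & t *: u = pA *: v].

Lemma pidem_x : pidem (xA p).
Proof. by split; [exact: xAxA | exact: maxideal_x | exact: x_maxideal]. Qed.
Lemma pidem_y : pidem (yA p).
Proof. by split; [exact: yAyA | exact: maxideal_y | exact: y_maxideal]. Qed.

Lemma pidemC t : pidem t -> pidem (pA - t).
Proof.
move=> [tt t1 tm]; split=> [|M u|M u um].
- by rewrite mulrBl !mulrBr tt; ring.
- by rewrite scalerBl; apply: maxidealB; [exact: maxideal_p | exact: t1].
have [v vm tu] := tm _ _ um.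
by exists (u - v); [exact: maxidealB | rewrite scalerBl tu scalerBr].
Qed.

Definition torsion_free (M : lmodType A) : Prop :=
  forall u : M, pA *: u = 0 -> u = 0.

Lemma torsion_free_inj (M : lmodType A) : torsion_free M ->
  injective (fun u : M => pA *: u).
Proof.
by move=> tf u v /eqP; rewrite -subr_eq0 -scalerBr => /eqP /tf /subr0_eq.
Qed.

(* With [t = p e], [e] an idempotent of [A^#]: the image of [M] in [M^# / p M^#]
   is a complement of [(1 - e) (M^# / p M^#)]. *)
Definition transverse (t : A) (M : lmodType A) : Prop :=
  (forall v : M, t *: v = 0 -> maxideal M v) /\
  (forall m, maxideal M m -> t *: m = pA *: m -> exists v, t *: v = m).

(** From t t = p t and torsion-freeness, m is fixed by t / p, hence m = t w for some w; then t kills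
    v - p w, which therefore lies in m M. *)
Lemma transverse_mod_p t (M : lmodType A) : pidem t -> torsion_free M ->
  transverse t M -> forall v m : M, maxideal M m -> t *: v = pA *: m ->
  maxideal M v.
Proof.
move=> [tt _ _] tf [inj surj] v m mm tv.
have /(surj _ mm)[w tw] : t *: m = pA *: m.
  by apply: (torsion_free_inj tf); rewrite /= scalerA mulrC -scalerA -tv scalerA tt
    -scalerA.
rewrite -(subrK (pA *: w) v); apply: maxidealD; last exact: maxideal_p.
by apply: inj; rewrite scalerBr scalerA mulrC -scalerA tw tv subrr.
Qed.

(** A diagram chase. The purity assumption, that m M meets L in m L, brings the error terms that
    come from L back under the transversality of L. *)
Lemma transverse_ext t (L M N : lmodType A)
    (i : {linear L -> M}) (q : {linear M -> N}) :
  pidem t -> torsion_free L -> torsion_free N -> short_exact i q ->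
  (forall u, maxideal M (i u) -> maxideal L u) ->
  transverse t L -> transverse t N -> transverse t M.
Proof.
move=> tp tfL tfN [iinj qsurj ex] pure trL [injN surjN].
split=> [v tv|m mm tm].
  have /injN /(maxideal_lift qsurj)[m mm qm] : t *: q v = 0.
    by rewrite -linearZ tv linear0.
  have [|u iu] := (ex (v - m)).1; first by rewrite linearB qm subrr.
  have [_ tM tmax] := tp.
  have [m' mm' tm] := tmax _ _ mm.
  have itu : i (t *: u) = - (pA *: m').
    by rewrite linearZ iu /= scalerBr tv tm sub0r.
  (* The equality i (t u) = - p m' makes p m' vanish in N, which is torsion-free, so m' itself comes
     from L. *)
  have /ex [u' iu'] : q m' = 0.
    apply: tfN; apply: oppr_inj; rewrite oppr0 -linearZ -linearN -itu.
    by apply/ex; exists (t *: u).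
  rewrite -(subrK m v) -iu; apply: maxidealD => //.
  apply: maxideal_linear; apply: (transverse_mod_p tp tfL trL (m := - u')).
    by apply: maxidealN; apply: pure; rewrite iu'.
  by apply: iinj; rewrite itu scalerN linearN [i (_ *: _)]linearZ iu'.
have [|n tn] := surjN _ (maxideal_linear q mm); first by rewrite -!linearZ tm.
have [v0 qv0] := qsurj n.
have [|u iu] := (ex (m - t *: v0)).1.
  by rewrite linearB linearZ /= qv0 tn subrr.
have [||u' tu'] := trL.2 u.
- apply: pure; rewrite iu; apply: maxidealB => //.
  by case: tp => _ tM _; apply: tM.
- apply: iinj; rewrite !linearZ iu /= !scalerBr tm !scalerA.
  by case: tp => -> _ _.
by exists (v0 + i u'); rewrite scalerDr -linearZ tu' iu addrC subrK.
Qed.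
End Overring.

(** * The residue spaces M / m M and the maps between them *)

Lemma cV_right_inverse (k : fieldType) (m n : nat) (B : 'M[k]_(m, n)) :
  (forall c : 'cV_m, exists x : 'cV_n, B *m x = c) -> exists S, B *m S = 1%:M.
Proof.
move=> Bsurj; have [s Bs] := boolp.choice (fun j => Bsurj (col j 1%:M)).
exists (\matrix_(i, j) s j i 0); apply/matrixP => i j.
have /colP/(_ i) := Bs j; rewrite !mxE => <-.
by apply: eq_bigr => l _; rewrite mxE.
Qed.

Section Residues.
Variables (R : idomainType) (p : R) (k : fieldType) (rho : {rmorphism R -> k}).
Hypothesis rho_surj : forall c, exists a, rho a = c.
Local Notation A := (overring p).
Local Notation maxideal M := (@maxideal_mul R p M).

Section SemiLinear.
Variables (M : lmodType A) (n : nat) (g : M -> 'cV[k]_n).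
Hypothesis gP : forall r u v, g (constA p r *: u + v) = rho r *: g u + g v.

Lemma constA1 : constA p 1 = 1. Proof. exact: val_inj. Qed.
Lemma constAN r : constA p (- r) = - constA p r. Proof. exact: val_inj. Qed.

Lemma semilinearB u v : g (u - v) = g u - g v.
Proof.
rewrite addrC -[- v](scaleN1r v) -constA1 -constAN gP.
by rewrite rmorphN rmorph1 scaleN1r addrC.
Qed.

Lemma semilinear0 : g 0 = 0.
Proof. by have := semilinearB 0 0; rewrite !subrr. Qed.

Lemma semilinear_sum (m : nat) (r : 'I_m -> R) (u : 'I_m -> M) :
  g (\sum_i constA p (r i) *: u i) = \sum_i rho (r i) *: g (u i).
Proof.
elim: m r u => [|m IH] r u; first by rewrite !big_ord0 semilinear0.
by rewrite !big_ord_recl gP IH.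
Qed.
End SemiLinear.

Definition residual_dim (M : lmodType A) (d : nat) : Prop :=
  exists pi : M -> 'cV_d, residual_coords rho (constA p) setT (maxideal M) pi.

(** The columns of [B] are the values of [g] at lifts of the basis vectors; any u differs from an
    R-combination of these lifts by an element of m M. *)
Lemma residual_lift (M : lmodType A) d (pi : M -> 'cV_d) n (g : M -> 'cV[k]_n) :
  residual_coords rho (constA p) setT (maxideal M) pi ->
  (forall r u v, g (constA p r *: u + v) = rho r *: g u + g v) ->
  (forall u, maxideal M u -> g u = 0) ->
  exists B : 'M_(n, d), forall u, g u = B *m pi u.
Proof.
move=> [piP pisurj piker] gP gker.
have piP' r u v : pi (constA p r *: u + v) = rho r *: pi u + pi v by apply: piP.
have /boolp.choice[l lP] : forall j : 'I_d, exists u, pi u = delta_mx j 0.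
  by move=> j; have [v] := pisurj (delta_mx j 0); exists v.
exists (\matrix_(i, j) g (l j) i 0) => u.
have [r rP] := boolp.choice (fun j => rho_surj (pi u j 0)).
have piu : pi u = pi (\sum_j constA p (r j) *: l j).
  rewrite (semilinear_sum piP') [LHS]matrix_sum_delta; apply: eq_bigr => j _.
  by rewrite big_ord1 lP rP.
have /gker : maxideal M (u - \sum_j constA p (r j) *: l j).
  by apply/piker => //; rewrite (semilinearB piP') piu subrr.
rewrite (semilinearB gP) => /subr0_eq ->; rewrite (semilinear_sum gP).
apply/colP => i; rewrite !mxE summxE; apply: eq_bigr => j _.
by rewrite !mxE rP mulrC.
Qed.

(* As ranks add up, the right exact sequence of residue spaces is exact. *)
Lemma short_exact_maxideal (L M N : lmodType A)
    (i : {linear L -> M}) (q : {linear M -> N}) dL dN :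
  short_exact i q -> residual_dim L dL -> residual_dim N dN ->
  residual_dim M (dL + dN) -> forall u, maxideal M (i u) -> maxideal L u.
Proof.
move=> [iinj qsurj ex] [piL rL] [piN rN] [piM rM] u ium.
have [piLP piLs piLk] := rL; have [piNP piNs piNk] := rN.
have [piMP piMs piMk] := rM.
have [||B1 B1P] := residual_lift (g := piM \o i) rL.
- by move=> r v w /=; rewrite linearP; apply: piMP.
- by move=> v vm; apply/piMk => //; apply: maxideal_linear.
have [||B2 B2P] := residual_lift (g := piN \o q) rM.
- by move=> r v w /=; rewrite linearP; apply: piNP.
- by move=> v vm; apply/piNk => //; apply: maxideal_linear.
have [S B2S] : exists S, B2 *m S = 1%:M.
  apply: cV_right_inverse => c; have [w _ <-] := piNs c.
  by have [v <-] := qsurj w; exists (piM v); rewrite -B2P.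
(* [B1] and [B2] are the residue maps of [i] and [q], and [S] splits [B2]. The matrix (B1 S) is onto
   by right exactness, and square because the dimensions add up; so it is invertible and [B1] is
   injective. *)
have [X BX] : exists X, row_mx B1 S *m X = 1%:M.
  apply: cV_right_inverse => c; have [v _ vc] := piMs (c - S *m (B2 *m c)).
  have qv : piN (q v) = 0.
    by rewrite [LHS]B2P vc mulmxBr (mulmxA B2) B2S mul1mx subrr.
  have [m mm qm] := maxideal_lift qsurj ((piNk _ I).1 qv).
  have [|w iw] := (ex (v - m)).1; first by rewrite linearB qm subrr.
  exists (col_mx (piL w) (B2 *m c)); rewrite mul_row_col -B1P /= iw.
  rewrite (semilinearB (g := piM)); last by move=> *; apply: piMP.
  by rewrite ((piMk m I).2 mm) subr0 vc subrK.
have := mulmx1C BX => XB.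
apply/(piLk _ I); have : row_mx B1 S *m col_mx (piL u) 0 = 0.
  by rewrite mul_row_col mulmx0 addr0 -B1P; apply/(piMk _ I).
move=> /(congr1 (mulmx X)); rewrite mulmxA XB mul1mx mulmx0.
by rewrite -[in X in _ = X -> _]col_mx0 => /eq_col_mx[].
Qed.
End Residues.

(** * The overmodule M^# and its four components *)

Section Sharp.
Variables (R : idomainType) (p : R).
Hypothesis p_neq0 : p != 0.
Local Notation A := (overring p).
Local Notation pA := (constA p p).
Local Notation p4 := (constR4 p).
Local Notation maxideal M := (@maxideal_mul R p M).
Variables (M : lmodType A) (N : lmodType (R4 R)) (j : M -> N).
Hypothesis sharp : is_sharp j.

Let jP (a : A) u v : j (a *: u + v) = val a *: j u + j v.
Proof. by have [] := sharp. Qed.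

Let j_inj : injective j. Proof. by have [] := sharp. Qed.

Lemma sharp0 : j 0 = 0.
Proof.
have := jP 1 0 0; rewrite scale1r addr0 rmorph1 scale1r => /eqP.
by rewrite -subr_eq0 opprD addrA subrr sub0r oppr_eq0 => /eqP.
Qed.

Lemma sharpZ a u : j (a *: u) = val a *: j u.
Proof. by have := jP a u 0; rewrite sharp0 !addr0. Qed.

Lemma sharpD u v : j (u + v) = j u + j v.
Proof. by have := jP 1 u v; rewrite rmorph1 !scale1r. Qed.

Lemma sharpB u v : j (u - v) = j u - j v.
Proof. by rewrite sharpD -scaleN1r sharpZ rmorphN1 scaleN1r. Qed.

Lemma sharp_p4_inj : injective (fun w : N => p4 *: w).
Proof.
have [_ _ tf _] := sharp => u v.
move=> /eqP; rewrite -subr_eq0 -scalerBr => /eqP/tf[/eqP|/subr0_eq //].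
by rewrite (negbTE p_neq0).
Qed.

Lemma sharp_torsion_free : torsion_free M.
Proof.
move=> u pu; apply: j_inj; rewrite sharp0; apply: sharp_p4_inj => /=.
by rewrite scaler0 -sharp0 -pu sharpZ.
Qed.

Lemma sharp_ind (Q : N -> Prop) : Q 0 -> (forall u v, Q u -> Q v -> Q (u + v)) ->
  (forall a v, Q (a *: j v)) -> forall w, Q w.
Proof.
by have [_ _ _ gen] := sharp => Q0 QD Qj w; have [n [a [v ->]]] := gen w;
  apply: big_ind.
Qed.

(** One half of m M = p M^#; [sharp_maxideal] is the other half. *)
Lemma sharp_p4 w : exists2 m, maxideal M m & j m = p4 *: w.
Proof.
move: w; apply: sharp_ind => [|u v [m mm jm] [n nm jn]|a v].
- by exists 0; [exact: maxideal0 | rewrite sharp0 scaler0].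
- by exists (m + n); [exact: maxidealD | rewrite sharpD jm jn scalerDr].
- rewrite scalerA scale_pR4 -sharpZ; eexists; last by [].
  by rewrite !scalerDl -!scalerA; do 4!eexists.
Qed.

Lemma x4E : x4 p = p4 * (idem R Vpp + idem R Vp0).
Proof. by congr (_, _, _, _); rewrite /= ?addr0 ?add0r ?mulr1 ?mulr0. Qed.
Lemma y4E : y4 p = p4 * (idem R Vpp + idem R V0p).
Proof. by congr (_, _, _, _); rewrite /= ?addr0 ?add0r ?mulr1 ?mulr0. Qed.
Lemma z4E : z4 p = p4 * idem R Vpp.
Proof. by congr (_, _, _, _); rewrite /= ?mulr1 ?mulr0. Qed.

Lemma sharp_maxideal m : maxideal M m -> exists w, j m = p4 *: w.
Proof.
move=> [v1 [v2 [v3 [v4 ->]]]]; rewrite !sharpD !sharpZ /= x4E y4E z4E.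
by rewrite -!scalerA -!scalerDr; eexists.
Qed.

Lemma idem_idem e : idem R e * idem R e = idem R e.
Proof. by case: e; congr (_, _, _, _); rewrite /= ?mulr1 ?mulr0. Qed.

Lemma idem_orth e f : e <> f -> idem R e * idem R f = 0.
Proof.
rewrite -[0 : R4 R]/((0, 0, 0, 0) : R4 R).
by case: e; case: f => // _; congr (_, _, _, _); rewrite /= ?mulr0 ?mul0r.
Qed.

Lemma idem_component e (w : N) : component4 p e (idem R e *: w).
Proof.
by split; rewrite !scalerA; congr (_ *: _); case: e; congr (_, _, _, _);
  rewrite /= ?mulr0 ?mul0r.
Qed.

Lemma component_idem e (w : N) : component4 p e w -> idem R e *: w = w.
Proof.
move=> [xw yw]; do 2!apply: sharp_p4_inj => /=.
rewrite !scalerA.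
(* The product X Y is p^2 times the idempotent of [e], while the eigenvalue equations make both X
   and Y act on [w] as p; it remains to cancel p^2. *)
set X := if e is (Vpp | Vp0) then x4 p else p4 - x4 p.
set Y := if e is (Vpp | V0p) then y4 p else p4 - y4 p.
have xe : X *: w = p4 *: w.
  by rewrite /X; case: e xw {yw X Y} => /= xw;
    rewrite ?scalerBl xw ?rmorph0 ?scale0r ?subr0.
have ye : Y *: w = p4 *: w.
  by rewrite /Y; case: e yw {xw xe X Y} => /= yw;
    rewrite ?scalerBl yw ?rmorph0 ?scale0r ?subr0.
transitivity ((X * Y) *: w).
  congr (_ *: _); rewrite /X /Y.
  by case: e {xe ye xw yw X Y}; congr (_, _, _, _);
    rewrite /= ?subrr ?subr0 ?mulr0 ?mul0r ?mulr1.
by rewrite -scalerA ye scalerA [X * p4]mulrC -!scalerA xe.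
Qed.

Lemma sharp_component e (w : N) :
  component4 p e w -> exists v, idem R e *: j v = w.
Proof.
move=> /component_idem <-; move: w; apply: sharp_ind => [|u v [u' eu] [v' ev]|a v].
- by exists 0; rewrite sharp0.
- by exists (u' + v'); rewrite sharpD !scalerDr eu ev.
(* On a single component A^# acts through one coordinate in R, and scalars from R already act on
   M. *)
- have [r ra] : exists r, idem R e * constR4 r = idem R e * a.
    case: a => [[[a1 a2] a3] a4].
    by case: e; [exists a1 | exists a2 | exists a3 | exists a4];
      congr (_, _, _, _); rewrite /= ?mul0r.
  by exists (constA p r *: v); rewrite sharpZ !scalerA ra.
Qed.
End Sharp.

(** * Transversality read off the representation Phi(M) *)

Section PhiIso.
Variables (R : idomainType) (p : R) (k : fieldType) (rho : {rmorphism R -> k}).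
Hypothesis p_neq0 : p != 0.
Local Notation A := (overring p).
Local Notation p4 := (constR4 p).
Local Notation maxideal M := (@maxideal_mul R p M).
Variables (M : lmodType A) (d0 : nat) (d : vertex -> nat) (V : rep k d0 d).
Hypothesis MV : Phi_iso rho M V.

Lemma Phi_iso_torsion_free : torsion_free M.
Proof. by have [N [j [sharp _]]] := MV; apply: sharp_torsion_free sharp. Qed.

Lemma Phi_iso_residual_dim : residual_dim rho M d0.
Proof. by have [N [j [_ [pi0 [pi [? _ _]]]]]] := MV; exists pi0. Qed.

Lemma Phi_iso_surj e (c : 'cV_(d e)) : exists c0, V e *m c0 = c.
Proof.
have [N [j [sharp [pi0 [pi [_ piP piV]]]]]] := MV.
have [_ /(_ c)[w we <-] _] := piP e.
have [v <-] := sharp_component p_neq0 sharp we.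
by exists (pi0 v); rewrite piV.
Qed.

(** The last two hypotheses make the map from V at the centre to the sum of its values at a and b
    bijective. Injectivity puts the kernel of t in m M; surjectivity gives a preimage modulo p M^#,
    and an element of m M corrects it. *)
Lemma Phi_iso_transverse a b (t : A) :
  a <> b -> val t = p4 * (idem R a + idem R b) ->
  (forall ca cb, exists c : 'cV_d0, V a *m c = ca /\ V b *m c = cb) ->
  (forall c : 'cV_d0, V a *m c = 0 -> V b *m c = 0 -> c = 0) ->
  transverse t M.
Proof.
move=> ab tE Vsurj Vinj.
have [N [j [sharp [pi0 [pi [pi0P piP piV]]]]]] := MV.
have [_ j_inj _ _] := sharp.
have [_ pi0s pi0k] := pi0P.
have iab : idem R a * idem R b = 0 by apply: idem_orth.
have iba : idem R b * idem R a = 0 by rewrite mulrC.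
have [iaa ibb] := (idem_idem R a, idem_idem R b).
have pi_eq e u w : component4 p e u -> component4 p e w -> pi e u = pi e w ->
    exists2 w', component4 p e w' & u - w = p4 *: w'.
  move=> ue we uw; have [pil _ pik] := piP e.
  have subE : u - w = constR4 (-1) *: w + u by rewrite rmorphN1 scaleN1r addrC.
  have [||w' ? <-] := (pik (u - w) _).1; last by exists w'.
    have := @idem_component _ p N e (u - w).
    by rewrite scalerBr !(component_idem p_neq0 sharp).
  by rewrite subE pil // uw rmorphN1 scaleN1r addNr.
have pi_0 e : pi e 0 = 0.
  have [_ _ pik] := piP e; have c0 : component4 p e (0 : N).
    by have := @idem_component _ p N e 0; rewrite scaler0.
  by apply/pik => //; exists 0; rewrite ?scaler0.
split=> [v tv|m mm tm].
  have ev : (idem R a + idem R b) *: j v = 0.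
    apply: (sharp_p4_inj p_neq0 sharp).
    by rewrite /= scaler0 scalerA -tE -(sharpZ sharp) tv (sharp0 sharp).
  apply/(pi0k _ I)/Vinj; rewrite -piV.
    have /(congr1 (fun w => idem R a *: w)) := ev.
    by rewrite /= scalerA mulrDr iaa iab addr0 scaler0 => ->; apply: pi_0.
  have /(congr1 (fun w => idem R b *: w)) := ev.
  by rewrite /= scalerA mulrDr iba ibb add0r scaler0 => ->; apply: pi_0.
have [w jm] := sharp_maxideal sharp mm.
have ew : (idem R a + idem R b) *: w = w.
  do 2!apply: (sharp_p4_inj p_neq0 sharp) => /=.
  have := congr1 j tm; rewrite !(sharpZ sharp) jm tE /= => <-.
  by rewrite !scalerA mulrAC.
have [c [ca cb]] := Vsurj (pi a (idem R a *: w)) (pi b (idem R b *: w)).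
have [v _ vc] := pi0s c; rewrite -vc -!piV in ca cb.
have [wa waa awE] := pi_eq a _ _ (idem_component _ _ _) (idem_component _ _ _) ca.
have [wb wbb bwE] := pi_eq b _ _ (idem_component _ _ _) (idem_component _ _ _) cb.
(* [v] has the residues of w at a and b, with error p (wa + wb); this error lies in the image of M
   and is subtracted. *)
have [m' _ jm'] := sharp_p4 sharp (wa + wb).
have iwa : (idem R a + idem R b) *: wa = wa.
  rewrite -[in LHS](component_idem p_neq0 sharp waa) scalerA mulrDl iaa iba addr0.
  exact: component_idem sharp _ _ waa.
have iwb : (idem R a + idem R b) *: wb = wb.
  rewrite -[in LHS](component_idem p_neq0 sharp wbb) scalerA mulrDl iab ibb add0r.
  exact: component_idem sharp _ _ wbb.
exists (v - m'); apply: j_inj; rewrite (sharpZ sharp) tE jm -[in RHS]ew -scalerA.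
congr (_ *: _); rewrite (sharpB sharp) jm' scalerBr.
rewrite [(_ + _) *: (p4 *: _)]scalerA mulrC -scalerA scalerDr iwa iwb.
by rewrite scalerDr -awE -bwE !scalerDl addrACA -opprD; apply: subKr.
Qed.
End PhiIso.

(** One of the targets is zero and the other a line, on which a surjective map from a line is
    bijective. *)
Lemma cV_complementary (k : fieldType) m n (B : 'M[k]_(m, 1)) (C : 'M[k]_(n, 1)) :
  (m + n = 1)%N ->
  (forall c, exists c0 : 'cV_1, B *m c0 = c) ->
  (forall c, exists c0 : 'cV_1, C *m c0 = c) ->
  (forall b c, exists c0 : 'cV_1, B *m c0 = b /\ C *m c0 = c) /\
  (forall c0 : 'cV_1, B *m c0 = 0 -> C *m c0 = 0 -> c0 = 0).
Proof.
have inj (D : 'M[k]_1) : (forall c, exists c0 : 'cV_1, D *m c0 = c) ->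
    forall c0 : 'cV_1, D *m c0 = 0 -> c0 = 0.
  move=> /(_ 1%:M)[d Dd] c0 Dc0.
  by rewrite -[c0]mul1mx -(mulmx1C Dd) -mulmxA Dc0 mulmx0.
case: m B => [|[|//]] B; case: n C => [|[|//]] C // _ Bs Cs; split.
- by move=> b c; have [c0 Cc0] := Cs c; exists c0; split; first rewrite !flatmx0.
- by move=> c0 _; apply: inj.
- by move=> b c; have [c0 Bc0] := Bs b; exists c0; split; last rewrite !flatmx0.
- by move=> c0 + _; apply: inj.
Qed.

(** * Transversality along the tubes *)

Section Tubes.
Variables (R : idomainType) (p : R) (k : fieldType) (rho : {rmorphism R -> k}).
Hypothesis rho_surj : forall c, exists a, rho a = c.
Hypothesis p_neq0 : p != 0.
Local Notation A := (overring p).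
Local Notation pA := (constA p p).
Local Notation p4 := (constR4 p).

(* The pairs of vertices in the supports of the two idempotents [e] and [1 - e]
   of [A^#], [t = p e]. *)
Record splitting (t : A) (a b c d : vertex) : Prop := Splitting {
  split_pidem : pidem t;
  split_ab : a <> b;
  split_cd : c <> d;
  split_l : val t = p4 * (idem R a + idem R b);
  split_r : val (pA - t) = p4 * (idem R c + idem R d)
}.

Lemma splitting_x : splitting (xA p) Vpp Vp0 V0p V00.
Proof.
split=> //; first exact: pidem_x; first exact: x4E.
by rewrite rmorphB; congr (_, _, _, _);
  rewrite /= ?addr0 ?add0r ?mulr0 ?mulr1 ?subrr ?subr0.
Qed.

Lemma splitting_y : splitting (yA p) Vpp V0p Vp0 V00.
Proof.
split=> //; first exact: pidem_y; first exact: y4E.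
by rewrite rmorphB; congr (_, _, _, _);
  rewrite /= ?addr0 ?add0r ?mulr0 ?mulr1 ?subrr ?subr0.
Qed.

(** The invariant carried up a tube; the residual dimension [d] is kept because purity of an
    extension rests on adding dimensions. *)
Definition bitransverse (t : A) (d : nat) (M : lmodType A) : Prop :=
  [/\ torsion_free M, residual_dim rho M d, transverse t M
    & transverse (pA - t) M].

Lemma bitransverse_ext t (L M N : lmodType A)
    (i : {linear L -> M}) (q : {linear M -> N}) dL dN d :
  pidem t -> short_exact i q -> bitransverse t dL L -> bitransverse t dN N ->
  Rk rho M (dL + dN) d -> bitransverse t (dL + dN) M.
Proof.
move=> tp ex [tfL rL tL tcL] [tfN rN tN tcN] [V MV].
have rM := Phi_iso_residual_dim MV.
have pure := short_exact_maxideal rho_surj ex rL rN rM.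
split=> //; first exact: Phi_iso_torsion_free MV.
  exact: transverse_ext ex pure tL tN.
exact: transverse_ext (pidemC tp) tfL tfN ex pure tcL tcN.
Qed.

Lemma Phi_iso_bitransverse (M : lmodType A) d0 d (V : rep k d0 d) t a b a' b' :
  splitting t a b a' b' -> Phi_iso rho M V ->
  (forall u v, exists c : 'cV_d0, V a *m c = u /\ V b *m c = v) /\
  (forall c : 'cV_d0, V a *m c = 0 -> V b *m c = 0 -> c = 0) ->
  (forall u v, exists c : 'cV_d0, V a' *m c = u /\ V b' *m c = v) /\
  (forall c : 'cV_d0, V a' *m c = 0 -> V b' *m c = 0 -> c = 0) ->
  bitransverse t d0 M.
Proof.
move=> [_ ab ab' tE tE'] MV [s i] [s' i'].
split; [exact: Phi_iso_torsion_free MV | exact: Phi_iso_residual_dim MV | |].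
  exact: Phi_iso_transverse MV _ _ _ ab tE s i.
exact: Phi_iso_transverse MV _ _ _ ab' tE' s' i'.
Qed.

Lemma homogeneous_bitransverse f m (M : lmodType A) :
  homogeneous rho f m M -> bitransverse (yA p) (2 * (size f).-1 * m) M.
Proof.
elim=> {m M} [M _ _ MV|m M L N L' N' i q i' q' _ _ MR _ iL _ iN ex _ _ _ _ _].
  rewrite muln1 mul2n -addnn; apply: (Phi_iso_bitransverse splitting_y MV).
    split=> [u v|c]; rewrite /tube_rep.
      (* Inverse of the block matrix with rows (I 0) and (I I), at the vertices where y = p. *)
      exists (col_mx u (v - u)); rewrite !mul_row_col !mul1mx mul0mx addr0.
      by rewrite addrC subrK.
    rewrite -[c]vsubmxK !mul_row_col !mul1mx mul0mx addr0 => ->.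
    by rewrite add0r => ->; rewrite col_mx0.
  split=> [u v|c]; rewrite /tube_rep.
    (* Inverse of the block matrix with rows (0 I) and (I F), at the vertices where y = 0. *)
    exists (col_mx (v - companionmx f *m u) u).
    by rewrite !mul_row_col !mul1mx mul0mx add0r subrK.
  rewrite -[c]vsubmxK !mul_row_col !mul1mx mul0mx add0r => ->.
  by rewrite mulmx0 addr0 => ->; rewrite col_mx0.
have E : (2 * (size f).-1 * m.+1 = 2 * (size f).-1 * 1 + 2 * (size f).-1 * m)%N.
  by rewrite -mulnDr.
rewrite E in MR *; exact: bitransverse_ext (pidem_y p) ex iL iN MR.
Qed.

Lemma exceptional_bitransverse l t a b c d i m (M : lmodType A) :
  splitting t a b c d ->
  (forall i, special_rank l i 1 a + special_rank l i 1 b = 1)%N ->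
  (forall i, special_rank l i 1 c + special_rank l i 1 d = 1)%N ->
  exceptional rho l i m M -> bitransverse t m M.
Proof.
move=> ts ab cd.
elim=> {i m M} [i M _ _ [V MV]|
  i m M L N L' N' g q g' q' _ _ MR _ iN _ iL ex _ _ _ _ _ _ _].
  have Vs := Phi_iso_surj p_neq0 MV.
  by apply: (Phi_iso_bitransverse ts MV); apply: cV_complementary.
rewrite -addn1 in MR *; exact: bitransverse_ext (split_pidem ts) ex iN iL MR.
Qed.

(** At the mouth of an exceptional tube each pair of vertices must have total rank 1. For y this
    holds at 0 and 1, but at infinity pp and 0p have equal ranks, so x takes over there. *)
Lemma in_tube_bitransverse (M : lmodType A) t : in_tube rho t M ->
  exists d, bitransverse (if t is Some _ then yA p else xA p) d M.
Proof.
case: t => [f|] /=; last first.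
  move=> [i [m Mm]]; exists m.
  by apply: exceptional_bitransverse splitting_x _ _ Mm => -[].
case: ifP => _; [|case: ifP => _].
- move=> [i [m Mm]]; exists m.
  by apply: exceptional_bitransverse splitting_y _ _ Mm => -[].
- move=> [i [m Mm]]; exists m.
  by apply: exceptional_bitransverse splitting_y _ _ Mm => -[].
- by move=> [_ _ [m /homogeneous_bitransverse Mm]]; eexists; exact: Mm.
Qed.
End Tubes.

(** * Padded cochains, and the reversal that exchanges x and y *)

Section Cochains.
Variables (A : comPzRingType) (M : lmodType A).
Implicit Types (s e D : nat -> A) (W b : nat -> M) (n : nat).

(* A cochain [w_0, ..., w_n] is shifted to [W i.+1 = w_i] and padded with
   [W 0 = W n.+2 = 0], so that the differential has no exceptional terms. *)
Definition cyc s e n W : Prop :=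
  [/\ W 0 = 0, W n.+2 = 0
    & forall i, (i <= n.+1)%N -> s i *: W i + e i *: W i.+1 = 0].
(** The minus sign accounts for the degree: the signed coefficient at [i.+1] in degree n is the
    opposite of the one at [i] in degree n - 1. *)
Definition cob s e n W : Prop :=
  exists b, [/\ b 0 = 0, b n.+1 = 0
    & forall i, (i <= n)%N -> W i.+1 = s i *: b i - e i.+1 *: b i.+1].

Definition single n (a : M) (i : nat) : M := if i == n.+1 then a else 0.

(** With u = 0 and D the coefficients in y, this is the second coefficient of the differential. The
    shift [u] absorbs the sign created by reversal. *)
Definition signed (u n : nat) D (i : nat) : A := (-1) ^+ (i + u) * D (n.+1 - i)%N.

Definition rev_cochain n W (i : nat) : M := W (n.+2 - i)%N.

Lemma signrZK (m : nat) (v : M) : (-1) ^+ m *: ((-1) ^+ m *: v) = v.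
Proof. by rewrite scalerA -expr2 -exprM mulnC exprM sqrrN expr1n expr1n scale1r. Qed.

Lemma cob_ext s e n W W' :
  (forall i, (i <= n)%N -> W i.+1 = W' i.+1) -> cob s e n W -> cob s e n W'.
Proof.
move=> WW [b [b0 bn bW]]; exists b; split=> // i i_n.
by rewrite -WW // bW.
Qed.

Lemma cyc_rev s D u n W : cyc s (signed u n D) n W ->
  cyc D (signed (n.+1 + u) n s) n (rev_cochain n W).
Proof.
move=> [W0 Wn WZ]; rewrite /rev_cochain; split=> [||i i_n].
- by rewrite subn0.
- by rewrite subnn.
have := WZ (n.+1 - i)%N (leq_subr _ _).
rewrite /signed subKn // subSS -subSn //.
set m := (n.+1 - i)%N; have -> : (i + (n.+1 + u) = i.*2 + (m + u))%N.
  by rewrite /m; lia.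
move=> /(congr1 (fun v => (-1) ^+ (m + u) *: v)).
rewrite scalerDr scaler0 -[(_ * D i) *: _]scalerA signrZK scalerA addrC => <-.
by rewrite exprD -mul2n exprM sqrrN !expr1n mul1r.
Qed.

Lemma cob_rev s D u n W : cob s (signed u n D) n W ->
  cob D (signed (n.+1 + u) n s) n (rev_cochain n W).
Proof.
move=> [b [b0 bn bW]].
(* The signs transfer the alternation from the coefficients [D] to the coefficients [s]. *)
exists (fun i => (-1) ^+ (n + i + u) *: b (n.+1 - i)%N); split=> [||i i_n].
- by rewrite subn0 bn scaler0.
- by rewrite subnn b0 scaler0.
rewrite /rev_cochain /signed !subSS subSn // bW ?leq_subr // /signed.
rewrite !subSS subKn // addrC scalerA -scaleNr; congr (_ + _).
  congr (_ *: _); rewrite -mulNr [RHS]mulrC; congr (_ * _).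
  rewrite addSn exprS mulN1r opprK.
  have -> : (n + i + u = i.*2 + (n - i + u))%N.
    by lia.
  by rewrite [RHS]exprD -mul2n exprM sqrrN !expr1n mul1r.
have -> : (i.+1 + (n.+1 + u) = (n + i.+1 + u).+1)%N by lia.
by rewrite exprS mulN1r mulNr scaleNr opprK mulrC -scalerA signrZK.
Qed.

Lemma signed_double u n D : signed (n.+1 + (n.+1 + u)) n D = signed u n D.
Proof.
apply: funext => i; rewrite /signed.
have -> : (i + (n.+1 + (n.+1 + u)) = n.+1.*2 + (i + u))%N by lia.
by rewrite [in LHS]exprD -mul2n exprM sqrrN !expr1n mul1r.
Qed.

Lemma cob_revE s D u n W : cob s (signed u n D) n W <->
  cob D (signed (n.+1 + u) n s) n (rev_cochain n W).
Proof.
split=> [|/cob_rev]; first exact: cob_rev.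
rewrite signed_double; apply: cob_ext => i i_n.
by rewrite /rev_cochain subKn // ltnS ltnW.
Qed.
End Cochains.

(** * Elimination in cocycles and coboundaries *)

Section Core.
Variables (R : idomainType) (p : R).
Local Notation A := (overring p).
Local Notation pA := (constA p p).
Local Notation maxideal M := (@maxideal_mul R p M).

Definition alt (t : A) (i : nat) : A := if odd i then t - pA else t.

Lemma alt_mul t i : pidem t -> alt t i.+1 * alt t i = 0.
Proof.
by move=> [tt _ _]; rewrite /alt /=; case: odd => /=;
  rewrite ?mulrBl ?mulrBr tt ?[t * pA]mulrC subrr.
Qed.

Lemma alt_pM (M : lmodType A) t i (v : M) :
  alt t i.+1 *: v = 0 -> alt t i *: v = (-1) ^+ i *: (pA *: v).
Proof.
rewrite /alt /= -signr_odd; case: odd => /=; rewrite ?expr0 ?expr1 scalerBl.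
  by move=> ->; rewrite sub0r scaleN1r.
by move=> /subr0_eq ->; rewrite scale1r.
Qed.

Variables (M : lmodType A) (t t' : A).
Hypotheses (tp : pidem t) (tp' : pidem t') (tf : torsion_free M).
Hypotheses (trans : transverse t M) (transC : transverse (pA - t) M).
Variables (n u : nat).
Implicit Types W b : nat -> M.
Local Notation s := (alt t').
Local Notation e := (signed u n (alt t)).

Lemma alt_maxideal i (v : M) : maxideal M v ->
  exists2 w, maxideal M w & s i *: v = pA *: w.
Proof.
move=> vm; have [_ _ tm] := tp'; have [w wm tw] := tm _ _ vm.
rewrite /alt; case: odd; last by exists w.
by exists (w - v); [exact: maxidealB | rewrite scalerBl tw scalerBr].
Qed.

Lemma alt_in_maxideal i (v : M) : maxideal M (s i *: v).
Proof.
have [_ tM _] := tp'; rewrite /alt; case: odd => //.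
by rewrite scalerBl; apply: maxidealB => //; apply: maxideal_p.
Qed.

Lemma signed_maxideal i (v m : M) : maxideal M m ->
  e i *: v = pA *: m -> maxideal M v.
Proof.
rewrite /signed -scalerA => mm /(congr1 (fun w => (-1) ^+ (i + u) *: w)).
rewrite signrZK scalerA mulrC -scalerA /alt; set w := _ *: m.
have wm : maxideal M w by apply: maxidealZ.
case: odd; last exact: transverse_mod_p.
rewrite -opprB scaleNr => tv.
apply: (transverse_mod_p (pidemC tp) tf transC (maxidealN wm)).
by rewrite scalerN -tv opprK.
Qed.

(** Up to sign, consecutive coefficients are t and t - p; being killed by one means being fixed by
    the idempotent of the other, so transversality applies. For i < n both indices n + 1 - i and n -
    i are positive. *)
Lemma signed_lift i (m : M) : (i < n)%N -> maxideal M m -> e i *: m = 0 ->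
  exists v, e i.+1 *: v = m.
Proof.
move=> i_n mm; rewrite /signed -scalerA.
move=> /(congr1 (fun w => (-1) ^+ (i + u) *: w)); rewrite signrZK scaler0.
rewrite subSn 1?ltnW // subSS => tm.
suff [v tv] : exists v, alt t (n - i) *: v = m.
  by exists ((-1) ^+ (i.+1 + u) *: v); rewrite mulrC -scalerA signrZK.
move: tm; rewrite /alt /=; case: odd => /= tm.
  have [|v tv] := transC.2 _ mm; first by rewrite scalerBl tm subr0.
  by exists (- v); rewrite scalerN -scaleNr opprB.
by have [|v tv] := trans.2 _ mm; [apply/subr0_eq; rewrite -scalerBl | exists v].
Qed.

Lemma signed_last (v : M) : e n *: v = 0 <-> alt t 1 *: v = 0.
Proof.
rewrite /signed subSnn -scalerA; split=> [|->]; last exact: scaler0.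
by move=> /(congr1 (fun w => (-1) ^+ (n + u) *: w)); rewrite signrZK scaler0.
Qed.

Lemma cyc_maxideal W : cyc s e n W -> forall i, (i <= n.+1)%N -> maxideal M (W i).
Proof.
move=> [W0 _ WZ]; elim=> [_|i IH i_n]; first by rewrite W0; apply: maxideal0.
have [m mm sm] := alt_maxideal i (IH (ltnW i_n)).
apply: (signed_maxideal (i := i) (maxidealN mm)).
by have /eqP := WZ i (ltnW i_n); rewrite addrC addr_eq0 sm scalerN => /eqP.
Qed.

(** By the cocycle equation the left side is a combination of products of consecutive coefficients
    in t', which vanish, and of two terms that cancel. *)
Lemma cyc_residue W b j : cyc s e n W -> (j <= n)%N -> b 0 = 0 ->
  (forall i, (i < j)%N -> W i.+1 = s i *: b i - e i.+1 *: b i.+1) ->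
  e j *: (W j.+1 - s j *: b j) = 0.
Proof.
move=> [W0 _ WZ] j_n b0 bW.
have /eqP := WZ j (leqW j_n); rewrite addrC addr_eq0 scalerBr => /eqP ->.
case: j {j_n} bW => [|j] bW; first by rewrite W0 b0 !scaler0 oppr0 addr0.
rewrite bW // scalerBr !scalerA alt_mul // scale0r sub0r opprK.
by rewrite mulrC subrr.
Qed.

(** Greedy solution from the left: the residue at j lies in m M and is killed by [e j], so it is a
    multiple of [e j.+1]. *)
Lemma cyc_partial W : cyc s e n W -> forall j, (j <= n)%N ->
  exists b, b 0 = 0 /\
    forall i, (i < j)%N -> W i.+1 = s i *: b i - e i.+1 *: b i.+1.
Proof.
move=> WZ; elim=> [|j IH] j_n; first by exists (fun=> 0).
have [b [b0 bW]] := IH (ltnW j_n).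
have rj := cyc_residue WZ (ltnW j_n) b0 bW.
have [|v ev] := signed_lift (m := W j.+1 - s j *: b j) j_n _ rj.
  apply: maxidealB; last exact: alt_in_maxideal.
  exact: cyc_maxideal WZ _ (leqW j_n).
exists (fun i => if i == j.+1 then - v else b i); split=> // i.
rewrite eqSS ltnS leq_eqVlt => /predU1P[->|i_j].
  by rewrite eqxx ltn_eqF // scalerN opprK ev addrC subrK.
by rewrite !ltn_eqF ?bW // (ltn_trans i_j).
Qed.

Lemma cyc_single (a : M) : alt t 1 *: a = 0 -> alt t' n.+1 *: a = 0 ->
  cyc s e n (single n a).
Proof.
move=> ta sa; rewrite /single; split=> [//||i i_n].
  by rewrite eqn_leq ltnn.
have [->|i_n1] := eqVneq i n.+1.
  by rewrite sa gtn_eqF // scaler0 addr0.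
rewrite scaler0 add0r eqSS; case: eqP => [->|_]; last exact: scaler0.
exact/signed_last.
Qed.

Lemma cyc_cob W : cyc s e n W -> exists a,
  [/\ alt t 1 *: a = 0, alt t' n.+1 *: a = 0
    & cob s e n (fun i => W i - single n a i)].
Proof.
move=> WZ; have [b [b0 bW]] := cyc_partial WZ (leqnn n).
(* The residue left at the last place, where b must be zero and nothing more can be solved. *)
exists (W n.+1 - s n *: b n); split.
- by apply/signed_last; apply: cyc_residue WZ _ b0 bW.
- have [_ Wn WZ'] := WZ.
  rewrite scalerBr scalerA alt_mul // scale0r subr0.
  by have := WZ' n.+1 (leqnn _); rewrite Wn scaler0 addr0.
exists (fun i => if (i <= n)%N then b i else 0); split=> // [|i i_n].
  by rewrite ltnn.
rewrite i_n /single eqSS; have [->|i_n'] := eqVneq i n.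
  by rewrite ltnn scaler0 subr0 subKr.
by rewrite subr0 ltn_neqAle i_n' i_n bW // ltn_neqAle i_n'.
Qed.

(** The vanishing entries force b_i into m M one after another, so a = s_n b_n lies in p m M. *)
Lemma cob_single_div (a : M) : cob s e n (single n a) -> exists m, a = pA *: m.
Proof.
move=> [b [b0 bn bW]].
have bm i : (i <= n)%N -> maxideal M (b i).
  elim: i => [_|i IH i_n]; first by rewrite b0; apply: maxideal0.
  have [m mm sm] := alt_maxideal i (IH (ltnW i_n)).
  apply: (signed_maxideal (i := i.+1) mm); have := bW i (ltnW i_n).
  by rewrite /single eqSS ltn_eqF // sm => /esym/subr0_eq/esym.
have [m _ sm] := alt_maxideal n (bm n (leqnn n)).
exists m; rewrite -sm; have := bW n (leqnn n).
by rewrite /single eqxx bn scaler0 subr0.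
Qed.

Lemma cob_single (m : M) : (0 < n)%N -> alt t 1 *: m = 0 ->
  alt t' n.+1 *: m = 0 -> cob s e n (single n (pA *: m)).
Proof.
(* On the kernel of the next coefficient, [alt t' n] is (-1)^n p, which this sign undoes. Positivity
   of n gives b_0 = 0. *)
move=> n0 tm sm; pose b i := if i == n then (-1) ^+ n *: m else 0.
exists b; rewrite /b; split=> [||i i_n]; first by rewrite ltn_eqF.
  by rewrite gtn_eqF.
have eb : e n *: ((-1) ^+ n *: m) = 0.
  by apply/signed_last; rewrite scalerA mulrC -scalerA tm scaler0.
rewrite /single eqSS; have [->|i_n'] := eqVneq i n.
  rewrite gtn_eqF // scaler0 subr0 scalerA mulrC -scalerA (alt_pM sm).
  by rewrite signrZK.
by rewrite scaler0 sub0r; case: eqP => [->|_]; rewrite ?eb ?scaler0 oppr0.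
Qed.
End Core.

(** * From homomorphisms on the resolution to padded sequences *)

Section Bridge.
Variables (R : idomainType) (p : R) (M : lmodType (overring p)).
Local Notation A := (overring p).
Local Notation K := (kleinian p).

Lemma inclKA_Cx i : inclKA (Cx p i) = alt (xA p) i.
Proof. by rewrite /Cx /alt; case: odd; rewrite ?rmorphB. Qed.
Lemma inclKA_Cy i : inclKA (Cy p i) = alt (yA p) i.
Proof. by rewrite /Cy /alt; case: odd; rewrite ?rmorphB. Qed.

Section KLinear.
Variables (n : nat) (g : resol p n -> M).
Hypothesis gK : K_linear g.

Lemma K_linear0 : g 0 = 0.
Proof.
have := gK 1 0 0; rewrite scale1r addr0 rmorph1 scale1r => /eqP.
by rewrite -subr_eq0 opprD addrA subrr sub0r oppr_eq0 => /eqP.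
Qed.
Lemma K_linearZ c u : g (c *: u) = inclKA c *: g u.
Proof. by have := gK c u 0; rewrite K_linear0 !addr0. Qed.
Lemma K_linearD u v : g (u + v) = g u + g v.
Proof. by have := gK 1 u v; rewrite rmorph1 !scale1r. Qed.
Lemma K_linear_sum m (c : 'I_m -> K) (u : 'I_m -> resol p n) :
  g (\sum_i c i *: u i) = \sum_i inclKA (c i) *: g (u i).
Proof.
elim: m c u => [|m IH] c u; first by rewrite !big_ord0 K_linear0.
by rewrite !big_ord_recl gK IH.
Qed.
Lemma K_linearE w : g w = \sum_i inclKA (w 0 i) *: g (monom p n i).
Proof.
rewrite {1}(row_sum_delta w) K_linear_sum; apply: eq_bigr => i _.
by rewrite /monom inord_val.
Qed.
End KLinear.

Definition coeffs n (g : resol p n -> M) (i : nat) : M :=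
  if (0 < i <= n.+1)%N then g (monom p n i.-1) else 0.

Lemma coeffsS n (g : resol p n -> M) i :
  (i <= n)%N -> coeffs g i.+1 = g (monom p n i).
Proof. by move=> i_n; rewrite /coeffs /= ltnS i_n. Qed.

Lemma K_linear_diff n (g : resol p n -> M) (w : resol p n.+1) : K_linear g ->
  g (diff w) = \sum_i inclKA (w 0 i) *:
    (alt (xA p) i *: coeffs g i + signed 0 n (alt (yA p)) i *: coeffs g i.+1).
Proof.
move=> gK; rewrite /diff K_linear_sum //; apply: eq_bigr => i _.
have i_n : (i <= n.+1)%N by rewrite -ltnS.
rewrite K_linearD // /coeffs i_n andbT /= subn_gt0; congr (_ *: (_ + _)).
  by case: ifP => _; rewrite ?K_linear0 ?scaler0 // K_linearZ // inclKA_Cx.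
case: ifP => _; rewrite ?K_linear0 ?scaler0 //.
rewrite /signed addn0 -scalerA -inclKA_Cy -!K_linearZ //.
have sgn (v : resol p n) (m : nat) : g ((-1) ^+ m *: v) = (-1) ^+ m *: g v.
  by rewrite K_linearZ // rmorphXn rmorphN1.
by rewrite -sgn.
Qed.

Lemma hom_of_K_linear n (b : 'I_n.+1 -> M) : K_linear (hom_of b).
Proof.
move=> c u v; rewrite /hom_of scaler_sumr -big_split; apply: eq_bigr => i _.
by rewrite !mxE rmorphD rmorphM scalerDl scalerA.
Qed.

Lemma hom_of_monom n (b : 'I_n.+1 -> M) (i : 'I_n.+1) : hom_of b (monom p n i) = b i.
Proof.
rewrite /hom_of (bigD1 i) //= big1 => [|l l_i].
  by rewrite addr0 /monom inord_val mxE !eqxx rmorph1 scale1r.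
by rewrite /monom inord_val mxE eqxx (negbTE l_i) rmorph0 scale0r.
Qed.

Lemma coeffs_hom_of n (b : nat -> M) i :
  coeffs (hom_of (fun i : 'I_n.+1 => b i)) i = if (0 < i <= n.+1)%N then b i.-1 else 0.
Proof.
rewrite /coeffs; case: i => [|i] //=; rewrite ltnS; case: leqP => // i_n.
by rewrite (hom_of_monom (fun i : 'I_n.+1 => b i) (Ordinal (i_n : i < n.+1)%N)).
Qed.

Lemma cocycleE n (g : resol p n -> M) : cocycle M n g <->
  K_linear g /\ cyc (alt (xA p)) (signed 0 n (alt (yA p))) n (coeffs g).
Proof.
split=> [[gK gZ]|[gK [_ _ gZ]]]; split=> //; last first.
  move=> w; rewrite K_linear_diff // big1 // => i _.
  by rewrite gZ ?scaler0 // -ltnS.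
split=> [//||i i_n]; first by rewrite /coeffs ltnn andbF.
have := gZ (monom p n.+1 i); rewrite K_linear_diff //.
rewrite (bigD1 (inord i)) //= big1 => [|l l_i].
  by rewrite addr0 /monom mxE !eqxx rmorph1 scale1r inordK.
by rewrite /monom mxE eqxx (negbTE l_i) rmorph0 scale0r.
Qed.

Lemma coboundaryE n (g : resol p n.+1 -> M) : K_linear g -> coboundary M n.+1 g <->
  cob (alt (xA p)) (signed 0 n.+1 (alt (yA p))) n.+1 (coeffs g).
Proof.
have sE i : signed 0 n.+1 (alt (yA p)) i.+1 = - signed 0 n (alt (yA p)) i :> A.
  by rewrite /signed subSS !addn0 exprS mulN1r mulNr.
move=> gK; split=> [[h [hK gh]]|[b [b0 bn bW]]].
  exists (coeffs h); split=> [//||i i_n]; first by rewrite /coeffs ltnn andbF.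
  rewrite sE scaleNr opprK coeffsS // gh K_linear_diff //.
  rewrite (bigD1 (inord i)) //= big1 => [|l l_i].
    by rewrite addr0 /monom mxE !eqxx rmorph1 scale1r inordK.
  by rewrite /monom mxE eqxx (negbTE l_i) rmorph0 scale0r.
(* The range includes the padding index [n.+2], where both sides are zero. *)
have hb i : (i <= n.+2)%N ->
    coeffs (hom_of (fun i : 'I_n.+1 => b i.+1)) i = b i.
  rewrite (coeffs_hom_of n (fun i => b i.+1)); case: i => [|i] //=.
  by rewrite ltnS leq_eqVlt => /predU1P[->|->//]; rewrite ltnn bn.
exists (hom_of (fun i : 'I_n.+1 => b i.+1)); split=> [|w].
  exact: hom_of_K_linear.
rewrite K_linear_diff; last exact: hom_of_K_linear.
rewrite K_linearE //; apply: eq_bigr => i _; congr (_ *: _).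
have i_n : (i <= n.+1)%N by rewrite -ltnS.
have := bW i i_n; rewrite sE scaleNr opprK coeffsS // => ->.
by rewrite !hb // (leq_trans i_n).
Qed.
End Bridge.

(** * The isomorphism for either direction of reading *)

Section Assembly.
Variables (R : idomainType) (p : R) (M : lmodType (overring p)).
Local Notation A := (overring p).
Local Notation pA := (constA p p).
Variables (t t' : A) (n u : nat).
Hypotheses (n_gt0 : (0 < n)%N) (tp : pidem t) (tp' : pidem t').
Hypotheses (tf : torsion_free M) (trans : transverse t M).
Hypothesis transC : transverse (pA - t) M.
Local Notation s := (alt t').
Local Notation e := (signed u n (alt t)).
Variables (W : (resol p n -> M) -> nat -> M) (xi : M -> resol p n -> M).
Hypotheses (WB : forall g h i, W (g - h) i = W g i - W h i).
Hypothesis cocW : forall g, cocycle M n g -> cyc s e n (W g).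
Hypothesis cobW : forall g, K_linear g -> coboundary M n g <-> cob s e n (W g).
Hypothesis cyc_xi : forall a, cyc s e n (single n a) -> cocycle M n (xi a).
Hypotheses (Wxi : forall a, W (xi a) = single n a).
Hypotheses (xiK : forall a, K_linear (xi a)).
Hypothesis xiP : forall (b : A) u v, xi (b *: u + v) = b *: xi u + xi v.
Variable S : set M.
Hypothesis SE : forall a, S a <-> alt t 1 *: a = 0 /\ alt t' n.+1 *: a = 0.

(** [W] lists the values of a cochain forwards, with t = y and t' = x, or backwards, with the roles
    exchanged; one argument then serves all tubes. *)
Lemma cochain_iso : (forall a, S a -> cocycle M n (xi a)) /\
  induces_iso S [set pA *: a | a in S] (cocycle M n) (coboundary M n) xi.
Proof.
have Sxi a : S a -> cocycle M n (xi a).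
  by move=> /SE[ta sa]; apply/cyc_xi/cyc_single.
split=> //; split=> // [a Sa|g gZ].
  rewrite cobW // Wxi; split=> [/(cob_single_div tp tp' tf trans transC)[m am]|].
    (* The quotient m satisfies the same annihilator conditions as a = p m, since M is
       torsion-free. *)
    exists m => //; apply/SE; move/SE: Sa => [ta sa].
    by split; apply: tf; rewrite scalerA mulrC -scalerA -am.
  by move=> [m /SE[tm sm] <-]; apply: cob_single.
have [a [ta sa gB]] := cyc_cob tp tp' tf trans transC (cocW gZ).
exists a; first exact/SE; apply/cobW.
  move=> c v w; have [gK _] := gZ.
  rewrite !fctE gK xiK scalerBr opprD.
  by rewrite addrACA.
by apply: cob_ext gB => i _; rewrite WB Wxi.
Qed.
End Assembly.

(** * The cochains xi_a, the components M(n), and the final statement *)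

Section Xi.
Variables (R : idomainType) (p : R) (M : lmodType (overring p)).
Local Notation A := (overring p).

Definition delta_hom n l (a : M) : resol p n -> M :=
  hom_of (fun i : 'I_n.+1 => if i == l :> nat then a else 0).

Arguments delta_hom n l a _ : clear implicits.

Lemma coeffs_delta_hom n l (a : M) i : (l <= n)%N ->
  coeffs (delta_hom n l a) i = if i == l.+1 then a else 0.
Proof.
move=> l_n; rewrite /delta_hom (coeffs_hom_of n (fun i => if i == l then a else 0)).
case: i => [|i] //=; rewrite ltnS eqSS; case: eqP => [->|_]; last by rewrite if_same.
by rewrite l_n.
Qed.

Lemma delta_homP n l (b : A) (u v : M) :
  delta_hom n l (b *: u + v) = b *: delta_hom n l u + delta_hom n l v.
Proof.
apply: funext => w; rewrite !fctE /delta_hom /hom_of scaler_sumr -big_split.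
apply: eq_bigr => i _ /=; case: ifP => _; rewrite ?scaler0 ?addr0 //.
by rewrite scalerDr !scalerA [b * _]mulrC.
Qed.

Lemma component_alt (q r : bool) (e : vertex) (a : M) :
  xval p e = (if q then p else 0) -> yval p e = (if r then p else 0) ->
  component e a <-> alt (xA p) q *: a = 0 /\ alt (yA p) r *: a = 0.
Proof.
move=> xe ye; rewrite /component /= xe ye.
have c0 : constA p 0 = 0 by apply: val_inj.
have altE (t : A) (b : bool) :
    t *: a = constA p (if b then p else 0) *: a <-> alt t b *: a = 0.
  rewrite /alt oddb; case: b; last by rewrite c0 scale0r.
  by rewrite scalerBl; split=> [->|/subr0_eq //]; rewrite subrr.
by split=> -[/altE xa /altE ya].
Qed.
End Xi.

Arguments delta_hom {R p M} n l a _.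

Theorem theorem3p3 (R : idomainType) (p : R) (k : fieldType)
    (rho : {rmorphism R -> k}) (M : lmodType (overring p)) (n : nat) :
  complete_dvr p -> residue_map p rho ->
  is_lattice M -> indecomposable M ->
  (exists t : option {poly k}, in_tube rho t M) ->
  (0 < n)%N ->
  (forall a : M, Mof rho M n a -> cocycle M n (xi rho M n a)) /\
  induces_iso (Mof rho M n) [set constA p p *: a | a in Mof rho M n]
    (cocycle M n) (coboundary M n) (xi rho M n).
Proof.
move=> [_ _ p_neq0 _] [rho_surj _] _ _ tubeM; case: n => // n _.
have altP t i : alt t i = alt t (odd i) :> overring p by rewrite /alt oddb.
have cob_coeffs (g : resol p n.+1 -> M) : K_linear g -> coboundary M n.+1 g <-> _ :=
  @coboundaryE _ _ _ _ g.
rewrite /Mof.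
have [toinfty|notinfty] := boolP `[< in_tube rho None M >].
  have xiE a : xi rho M n.+1 a = delta_hom n.+1 0 a by rewrite /xi toinfty.
  have [d [tf _ tr trC]] := in_tube_bitransverse rho_surj p_neq0 (asboolW toinfty).
  have revW a : rev_cochain n.+1 (coeffs (xi rho M n.+1 a)) = single n.+1 a.
    apply: funext => i; rewrite /rev_cochain xiE coeffs_delta_hom // /single.
    by congr (if _ then _ else _); lia.
  (* In degree [n.+1], reversal turns the sign shift 0 into [n.+2]. *)
  apply: (@cochain_iso _ _ _ _ _ n.+1 (n.+2 + 0)%N isT (pidem_x p) (pidem_y p)
    tf tr trC (fun g => rev_cochain n.+1 (coeffs g))).
  - by move=> g h i; rewrite /rev_cochain /coeffs; case: ifP; rewrite ?subr0.
  - by move=> g /cocycleE[_] /cyc_rev.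
  - by move=> g gK; rewrite cob_coeffs // cob_revE.
  - move=> a /cyc_rev; rewrite signed_double => ca; apply/cocycleE; split.
      exact: hom_of_K_linear.
    suff <- : rev_cochain n.+1 (single n.+1 a) = coeffs (xi rho M n.+1 a) by [].
    apply: funext => i; rewrite /rev_cochain xiE coeffs_delta_hom // /single.
    by congr (if _ then _ else _); lia.
  - exact: revW.
  - by move=> a; exact: hom_of_K_linear.
  - by move=> b u v; rewrite !xiE delta_homP.
  (* The conditions are (x - p) a = 0 and the vanishing of the y-coefficient of index [n.+2]. By
     parity this means y = p when the degree [n.+1] is even and y = 0 when it is odd. *)
  - move=> a; rewrite (altP (yA p)) /= negbK.
    by apply: (@component_alt _ _ _ true (odd n)); case: odd.
have xiE a : xi rho M n.+1 a = delta_hom n.+1 n.+1 a.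
  by rewrite /xi (negbTE notinfty).
have [d [tf _ tr trC]] : exists d, bitransverse rho (yA p) d M.
  case: tubeM => -[f|] tM; first exact: in_tube_bitransverse tM.
  by move/asboolP: notinfty.
have coeffs_xi a : coeffs (xi rho M n.+1 a) = single n.+1 a.
  by apply: funext => i; rewrite xiE coeffs_delta_hom.
apply: (@cochain_iso _ _ _ _ _ n.+1 0%N isT (pidem_y p) (pidem_x p) tf tr trC
  (@coeffs _ _ M _)).
- by move=> g h i; rewrite /coeffs; case: ifP; rewrite ?subr0.
- by move=> g /cocycleE[].
- exact: cob_coeffs.
- move=> a ca; apply/cocycleE; rewrite coeffs_xi; split=> //.
  exact: hom_of_K_linear.
- exact: coeffs_xi.
- by move=> a; exact: hom_of_K_linear.
- by move=> b u v; rewrite !xiE delta_homP.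
- move=> a; rewrite (altP (xA p)) /= negbK.
  by rewrite and_comm; apply: (@component_alt _ _ _ (odd n) true); case: odd.
Qed.
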